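(* Let $A$ be a Banach algebra (over $\mathbb{R}$ or $\mathbb{C}$) that contains a dense subalgebra $A_0$ such that multiplication restricted to this subalgebra (i.e. the map $A_0\times A_0\to A_0$, $(a,b)\mapsto ab$) is uniformly open. Then $A$ has uniformly open multiplication.
   Context: For a normed algebra $N$ (not necessarily complete), multiplication in $N$ is uniformly open if for every $\varepsilon>0$ there is $\delta>0$ such that for all $x,y\in N$ one has $B_N(xy,\delta)\subseteq B_N(x,\varepsilon)\cdot B_N(y,\varepsilon)$, where $B_N(x,r)$ is the open ball in $N$ with centre $x$ and radius $r$, and $U\cdot V=\{uv\colon u\in U,v\in V\}$. $A_0$ carries the norm of $A$. *)

(* Defs.v *)
From HB Require Import structures.
From mathcomp Require Import all_boot all_order all_algebra.
From mathcomp Require Import all_classical all_reals all_analysis.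
From mathcomp Require Export complex.

Set Implicit Arguments.
Unset Strict Implicit.
Unset Printing Implicit Defensive.

Import Order.TTheory GRing.Theory Num.Theory.
Import numFieldNormedType.Exports.

Local Open Scope classical_set_scope.
Local Open Scope ring_scope.

(* The ring and algebra structures of ssralg are unital, whereas a normed
   algebra need not have a unit: the product is added here to a normed module
   directly. *)
HB.mixin Record NormedModule_isNormedAlgebra (K : numFieldType) V
    & NormedModule K V := {
  nalg_mul : V -> V -> V;
  nalg_mulA : associative nalg_mul;
  nalg_mulDl : left_distributive nalg_mul +%R;
  nalg_mulDr : right_distributive nalg_mul +%R;
  nalg_scaleAl : forall (k : K) (x y : V),
    k *: nalg_mul x y = nalg_mul (k *: x) y;
  nalg_scaleAr : forall (k : K) (x y : V),
    k *: nalg_mul x y = nalg_mul x (k *: y);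
  nalg_ler_normM : forall x y : V, `|nalg_mul x y| <= `|x| * `|y|
}.

#[short(type="normedAlgType")]
HB.structure Definition NormedAlgebra (K : numFieldType) :=
  {V of NormedModule K V & NormedModule_isNormedAlgebra K V}.

#[short(type="banachAlgType")]
HB.structure Definition BanachAlgebra (K : numFieldType) :=
  {V of NormedAlgebra K V & Complete V}.

Section uniformly_open_multiplication.
Variables (K : numFieldType) (A : normedAlgType K).

Definition subalgebra (N : set A) :=
  submod_closed [in N] /\ (forall x y, N x -> N y -> N (nalg_mul x y)).

(* For a subalgebra N of A with the norm of A, ball_in N x r is the open ball
   of the normed algebra N; the algebra A itself is the case N = setT. *)
Definition ball_in (N : set A) (x : A) (r : K) : set A := N `&` ball x r.

Definition uniformly_open_mul (N : set A) :=
  forall e : K, 0 < e -> exists2 d : K, 0 < d &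
    forall x y, N x -> N y ->
      ball_in N (nalg_mul x y) d `<=`
        [set nalg_mul u v | u in ball_in N x e & v in ball_in N y e].

End uniformly_open_multiplication.

(* Main.v *)
(* Approximating x and y from A0, the point z lies close to a product x_0 y_0
   of elements of A0.  If |z - x_n y_n| < d_n, where d_n is the modulus of
   openness of A0 at precision e/2^(n+2), then a point of A0 near both x_n y_n
   and z is a product x_{n+1} y_{n+1} with factors within e/2^(n+2) of the old
   ones; choosing that point close enough to z restarts the argument with
   d_{n+1}.  The factors form Cauchy sequences, and the product of their limits
   is z by continuity of the multiplication. *)
Require Import Defs.
From mathcomp Require Import all_boot all_order all_algebra.
From mathcomp Require Import all_classical all_reals all_analysis.
From mathcomp Require Import ring.

Set Implicit Arguments.
Unset Strict Implicit.
Unset Printing Implicit Defensive.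

Import Order.TTheory GRing.Theory Num.Theory.
Import numFieldNormedType.Exports.
Local Open Scope classical_set_scope.
Local Open Scope ring_scope.
Local Open Scope complex_scope.

Lemma half_expn_gt0 (K : numFieldType) (e : K) (n : nat) :
  0 < e -> 0 < e / 2 ^+ n.
Proof. by move=> e0; rewrite divr_gt0 ?exprn_gt0. Qed.

Lemma half_expnS (K : numFieldType) (e : K) (n : nat) :
  e / 2 ^+ n.+1 + e / 2 ^+ n.+1 = e / 2 ^+ n.
Proof. by rewrite exprSr invfM mulrA -splitr. Qed.

Lemma nalg_mulBr (K : numFieldType) (A : normedAlgType K) (a u v : A) :
  nalg_mul a u - nalg_mul a v = nalg_mul a (u - v).
Proof. by rewrite nalg_mulDr -(scaleN1r v) -nalg_scaleAr scaleN1r. Qed.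

Lemma nalg_mulBl (K : numFieldType) (A : normedAlgType K) (a u v : A) :
  nalg_mul u a - nalg_mul v a = nalg_mul (u - v) a.
Proof. by rewrite nalg_mulDl -(scaleN1r v) -nalg_scaleAl scaleN1r. Qed.

Lemma cvg_nalg_mul (K : numFieldType) (A : normedAlgType K) (T : Type)
    (F : set_system T) {FF : Filter F} (f g : T -> A) (a b : A) :
  f @ F --> a -> g @ F --> b ->
  (fun t => nalg_mul (f t) (g t)) @ F --> nalg_mul a b.
Proof.
move=> fa gb; apply/cvgrPdist_lt => e e0.
have a1 : 0 < `|a| + 1 by rewrite ltr_wpDl.
have b1 : 0 < `|b| + 1 by rewrite ltr_wpDl.
near=> t.
rewrite (_ : _ - _ = nalg_mul a (b - g t) + nalg_mul (a - f t) (g t)); last first.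
  by rewrite -nalg_mulBr -nalg_mulBl addrA subrK.
rewrite (splitr e) (le_lt_trans (ler_normD _ _))// ltrD//.
- rewrite (le_lt_trans (nalg_ler_normM _ _))//.
  apply: (@le_lt_trans _ _ ((`|a| + 1) * `|b - g t|)).
    by rewrite ler_wpM2r// lerDl.
  rewrite mulrC -ltr_pdivlMr//.
  by near: t; move/cvgrPdist_lt : gb; apply; rewrite !divr_gt0.
- rewrite (le_lt_trans (nalg_ler_normM _ _))//.
  apply: (@le_lt_trans _ _ (`|a - f t| * (`|b| + 1))).
    rewrite ler_wpM2l//; near: t.
    by apply: (cvgr_norm_le b) => //; rewrite ltrDl.
  rewrite -ltr_pdivlMr//.
  by near: t; move/cvgrPdist_lt : fa; apply; rewrite !divr_gt0.
Unshelve. all: by end_near. Qed.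

Section geometric_steps.
Context (K : numFieldType) (e : K) (e0 : 0 < e).

(** The first step uses half of the radius [e / 2 ^+ n]; by induction the remaining [k] steps,
    started at [n.+1], stay within the other half. *)
Lemma geometric_steps_dist (V : normedModType K) (x : nat -> V) :
  (forall n, ball (x n) (e / 2 ^+ n.+1) (x n.+1)) ->
  forall n k, ball (x n) (e / 2 ^+ n) (x (n + k)%N).
Proof.
move=> xS n k; elim: k n => [|k IH] n.
  by rewrite addn0; apply/ballxx/half_expn_gt0.
by rewrite addnS -addSn -half_expnS; apply: ball_triangle (xS n) (IH n.+1).
Qed.

(** The decay of [1 / 2 ^+ n] is assumed because a general [numFieldType] may be non-archimedean; it
    makes the tails shrink, so the sequence is Cauchy. *)
Lemma geometric_steps_cvg (V : completeNormedModType K) (x : nat -> V) :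
  (forall d : K, 0 < d -> \forall n \near \oo, 1 / 2 ^+ n < d) ->
  (forall n, ball (x n) (e / 2 ^+ n.+1) (x n.+1)) ->
  cvg (x @ \oo).
Proof.
move=> K0 xS; apply/cauchy_cvgP/cauchyP => d d0.
have [n _ /(_ n (leqnn n)) nd] := K0 _ (divr_gt0 d0 e0).
exists (x n); exists n => // m nm.
rewrite -(subnKC nm); apply: (le_ball _ (geometric_steps_dist xS _ _)).
by rewrite mulrC -[leRHS](divfK (lt0r_neq0 e0)) ler_pM2r// ltW// -div1r.
Qed.

End geometric_steps.

Section dense_subset.
Context (K : numFieldType).

Lemma dense_ball (V : normedModType K) (N : set V) (x : V) (r : K)
    (P : set V) :
  dense N -> 0 < r -> nbhs x P -> exists2 u, N u & P u /\ ball x r u.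
Proof.
move=> dN r0 Px.
have /dN : (P° `&` ball x r) !=set0.
  by exists x; split; [exact: nbhs_singleton (nbhs_interior Px)|exact: ballxx].
case=> [|u [[Pu xu] Nu]]; last first.
  by exists u => //; split => //; exact: interior_subset.
by apply: openI; [exact: open_interior|exact: ball_open].
Qed.

Context (A : normedAlgType K) (N : set A).
Hypothesis dN : dense N.

(** One step of the iteration: a point of [N] near [z] that is still within [d0] of [nalg_mul x y]
    gets factored. The radius [d1] lets the next step start, while [r] forces the products towards
    [z], since moduli of openness need not tend to 0. *)
Lemma refine_factors (d0 d1 r e : K) (x y z : A) :
  (forall x y, N x -> N y ->
      ball_in N (nalg_mul x y) d0 `<=`
        [set nalg_mul u v | u in ball_in N x e & v in ball_in N y e]) ->
  0 < d1 -> 0 < r ->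
  N x -> N y -> ball z d0 (nalg_mul x y) ->
  exists u v, [/\ N u, N v, ball z d1 (nalg_mul u v), ball z r (nalg_mul u v)
    & ball x e u /\ ball y e v].
Proof.
move=> Nopen d10 r0 Nx Ny zxy.
have Pz : nbhs z (ball z d1 `&` ball (nalg_mul x y) d0).
  apply: filterI; first exact: nbhsx_ballx.
  by apply: open_nbhs_nbhs; split; [exact: ball_open|exact: ball_sym].
have [w Nw [[zw1 xyw] zw]] := dense_ball dN r0 Pz.
have [//|u [Nu xu] [v [Nv yv] uvw]] := Nopen x y Nx Ny w.
by exists u, v; rewrite uvw.
Qed.

(** Starting pair of the iteration. The factors are moved into [N] one at a time, [x] first, by
    continuity in each variable; the product stays in the open ball around [z]. *)
Lemma approx_factors (d e : K) (x y z : A) :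
  0 < e -> ball (nalg_mul x y) d z ->
  exists u v, [/\ N u, N v, ball z d (nalg_mul u v), ball x e u & ball y e v].
Proof.
move=> e0 /ball_sym zxy.
have zN : nbhs (nalg_mul x y) (ball z d).
  by apply: open_nbhs_nbhs; split => //; exact: ball_open.
have xN : nbhs x [set u | ball z d (nalg_mul u y)].
  have : nalg_mul u y @[u --> x] --> nalg_mul x y.
    by apply: cvg_nalg_mul; [exact: cvg_id|exact: cvg_cst].
  by move/(_ _ zN).
have [u Nu [zuy xu]] := dense_ball dN e0 xN.
have zN' : nbhs (nalg_mul u y) (ball z d).
  by apply: open_nbhs_nbhs; split => //; exact: ball_open.
have yN : nbhs y [set v | ball z d (nalg_mul u v)].
  have : nalg_mul u v @[v --> y] --> nalg_mul u y.
    by apply: cvg_nalg_mul; [exact: cvg_cst|exact: cvg_id].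
  by move/(_ _ zN').
have [v Nv [zuv yv]] := dense_ball dN e0 yN.
by exists u, v.
Qed.

End dense_subset.

Lemma uniformly_open_mul_dense (K : numFieldType) (A : banachAlgType K)
    (N : set A) :
  (forall d : K, 0 < d -> \forall n \near \oo, 1 / 2 ^+ n < d) ->
  dense N -> uniformly_open_mul N -> uniformly_open_mul [set: A].
Proof.
move=> K0 dN Nopen e e0.
have e20 : 0 < e / 2 by rewrite divr_gt0.
pose g n : K := e / 2 / 2 ^+ n.
have g0 n : 0 < g n by exact: half_expn_gt0.
have /choice[d dP] : forall n, exists d, 0 < d /\ forall x y, N x -> N y ->
    ball_in N (nalg_mul x y) d `<=`
      [set nalg_mul u v | u in ball_in N x (g n.+1) & v in ball_in N y (g n.+1)].
  by move=> n; have [d d0 dP] := Nopen _ (g0 n.+1); exists d.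
(* The modulus of [N] at precision [g 1], a quarter of [e], serves for the whole algebra at
   precision [e]. *)
exists (d 0%N); first by case: (dP 0%N).
move=> x y _ _ z [_ xyz].
have [x0 [y0 [Nx0 Ny0 zxy0 xx0 yy0]]] :=
  approx_factors dN (g0 1%N) xyz.
pose inv n (s : A * A) := [/\ N s.1, N s.2 & ball z (d n) (nalg_mul s.1 s.2)].
pose close n (s t : A * A) := [/\ ball s.1 (g n.+1) t.1, ball s.2 (g n.+1) t.2
  & ball z (g n) (nalg_mul t.1 t.2)].
have /choice[f fP] : forall ns : nat * (A * A), exists t, inv ns.1 ns.2 ->
    inv ns.1.+1 t /\ close ns.1 ns.2 t.
  (* Choice needs a value at every pair; where [inv] fails, [s] is a dummy. *)
  move=> [n s] /=; have [[Ns1 Ns2 zs]|] := pselect (inv n s); last by exists s.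
  have [u [v [Nu Nv zuv zuv' [su sv]]]] :=
    refine_factors dN (dP n).2 (dP n.+1).1 (g0 n) Ns1 Ns2 zs.
  by exists (u, v).
pose s := fix s n := if n is m.+1 then f (m, s m) else (x0, y0).
have sinv n : inv n (s n) by elim: n => //= n IH; case: (fP (n, s n) IH).
have sclose n : close n (s n) (s n.+1) by case: (fP (n, s n) (sinv n)).
pose xs n := (s n).1; pose ys n := (s n).2.
have xS n : ball (xs n) (g n.+1) (xs n.+1) by case: (sclose n).
have yS n : ball (ys n) (g n.+1) (ys n.+1) by case: (sclose n).
have limit_close (a : A) (w : nat -> A) : ball a (g 1%N) (w 0%N) ->
    (forall n, ball (w n) (g n.+1) (w n.+1)) ->
    exists2 l, w @ \oo --> l & ball a e l.
  move=> aw wS; have /cvg_ex[l wl] := geometric_steps_cvg e20 K0 wS.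
  exists l => //; have [k _ /(_ k (leqnn k)) wkl] :=
    (cvgrPdist_lt _ _).1 wl _ (g0 1%N).
  (* Error budget: [g 1] for the initial approximation, [g 0] for all steps up to [k] together,
     [g 1] from [w k] to the limit. *)
  have -> : e = g 1%N + g 0%N + g 1%N by rewrite /g; field.
  apply: (@ball_triangle _ _ (w k)); last first.
    by apply: ball_sym; rewrite -ball_normE.
  by apply: ball_triangle aw _; exact: (geometric_steps_dist e20 wS 0%N k).
have [u xu uP] := limit_close _ _ xx0 xS.
have [v yv vP] := limit_close _ _ yy0 yS.
exists u => //; exists v => //.
(* Both [nalg_mul u v] and [z] are limits of the products. The index is shifted because [close n]
   controls the product at [n.+1]. *)
apply: (@norm_cvg_unique _ _ ((fun n => nalg_mul (xs n.+1) (ys n.+1)) @ \oo)).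
  have : nalg_mul (xs n) (ys n) @[n --> \oo] --> nalg_mul u v by exact: cvg_nalg_mul.
  by rewrite -(cvg_shiftS (fun n => nalg_mul (xs n) (ys n))).
apply/cvgrPdist_lt => r r0; near=> n.
have [_ _] := sclose n; rewrite -ball_normE => /lt_trans; apply.
rewrite -[ltRHS](divfK (lt0r_neq0 e20)) /g mulrC ltr_pM2r// -div1r.
by near: n; apply: K0; rewrite divr_gt0.
Unshelve. all: by end_near. Qed.

(** A positive element of [R[i]] has zero imaginary part, so the claim reduces to its real part. *)
Lemma half_expn_lt_complex (R : realType) (d : R[i]) :
  0 < d -> \forall n \near \oo, 1 / 2 ^+ n < d.
Proof.
case: d => a b; rewrite ltcE /= => /andP[/eqP-> a0].
apply: filterS (near_infty_natSinv_expn_lt (PosNum a0)) => n /=.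
by rewrite -ltcR rmorphM rmorph1 fmorphV rmorphXn rmorph_nat.
Qed.

Theorem proposition3p4 (R : realType) :
  (forall (A : banachAlgType R) (A0 : set A),
     subalgebra A0 -> dense A0 -> uniformly_open_mul A0 ->
     uniformly_open_mul [set: A]) /\
  (forall (A : banachAlgType R[i]) (A0 : set A),
     subalgebra A0 -> dense A0 -> uniformly_open_mul A0 ->
     uniformly_open_mul [set: A]).
Proof.
split=> A A0 _; apply: uniformly_open_mul_dense => d d0.
- exact: (near_infty_natSinv_expn_lt (PosNum d0)).
- exact: half_expn_lt_complex.
Qed.
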